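(* Let $(X_k)_{k\ge0}$, $X_k=(X^{(1)}_k,\dots,X^{(m)}_k)\in\mathbb{R}^{md}$, be the Euler–Maruyama discretization with step-size $h>0$ of the decentralized Langevin dynamics, $$X_{k+1}=\left((1-h)\mathbf{I}+h\mathbf{W}\right)X_k-\alpha_{k+1}h\nabla U_v(X_k)+\sqrt{2\sigma\alpha_{k+1}h}\,Z_{k+1},\qquad \alpha_k=\frac{1}{1+k},$$ with the network, potentials and standing assumptions given in the context. Let $\check{X}_k:=X_k-\mathbf{1}_m\otimes\bar{X}_k$ be the consensus error, where $\bar X_k=\frac1m\sum_{i=1}^m X^{(i)}_k$, and let $\nu_k$ be the distribution of $\check{X}_k$. Then for any $\gamma>0$, $\nu_k$ converges in $W_2$ distance to the Dirac delta $\delta_0$ at zero, at the rate $$W_2(\nu_k,\delta_0)=O\left(\frac{1}{(1+k)^{1/2-\gamma}}\right).$$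
   Context: Network: there are $m$ agents, the vertices $\mathcal{V}=\{1,\dots,m\}$ of a fixed undirected (strongly) connected graph $\mathcal{G}=(\mathcal{V},\mathcal{E})$. $\mathbf{A}\in\mathbb{R}^{m\times m}$ is a symmetric doubly stochastic matrix with $\mathbf{A}_{ij}\neq0$ if $(i,j)\in\mathcal{E}$ and $\mathbf{A}_{ij}=0$ otherwise (self-loops $(i,i)\in\mathcal{E}$ are allowed). $\mathbf{W}=\mathbf{A}\otimes I_d$ and $\mathbf{L}=\mathbf{I}-\mathbf{W}$ (the graph Laplacian, acting on $\mathbb{R}^{md}$). The eigenvalues of $\mathbf{A}$ are real and sorted as $1=\lambda_1(\mathbf{A})>\lambda_2(\mathbf{A})\ge\dots\ge\lambda_m(\mathbf{A})\ge0$, and it is assumed that $\beta:=\lambda_2(\mathbf{A})<1$. Potentials: $u_1,\dots,u_m:\mathbb{R}^d\to\mathbb{R}$ are continuously differentiable, $U(x)=\sum_{i=1}^m u_i(x)$, and for a stacked vector $X=(X^{(1)},\dots,X^{(m)})\in\mathbb{R}^{md}$, $U_v(X)=\sum_{i=1}^m u_i(X^{(i)})$. It is assumed that, for all $x,y\in\mathbb{R}^d$: $\|\nabla U(x)-\nabla U(y)\|\le L\|x-y\|$; $U$ is strongly convex with a constant $\mu>0$, i.e. $U(x)-U(y)-\nabla U(y)^T(x-y)\ge\frac{\mu}{2}\|x-y\|^2$; and for all $i,j$, $\|\nabla u_i(x)-\nabla u_j(y)\|\le G\|x-y\|$. Noise: $\sigma>0$, and $Z_k=(Z^{(1)}_k,\dots,Z^{(m)}_k)$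 where the $Z^{(i)}_k$ are independent standard Gaussian vectors in $\mathbb{R}^d$. The initial condition $X_0$ is a random vector. $\mathbf{1}_m$ is the all-ones vector in $\mathbb{R}^m$. Wasserstein distance: for measures $\mu',\nu'$ on Euclidean space and $q\ge1$, $W_q(\mu',\nu')=\left(\inf_{\rho}\int\|x-y\|_2^q\,d\rho(x,y)\right)^{1/q}$, the infimum being over all joint distributions $\rho$ with marginals $\mu'$ and $\nu'$.
   Formalization: The step-size is additionally required to satisfy h(1-λ_m(A)) < 2, and the initial consensus error X_0 - 1⊗mean(X_0) to have finite second moment; without these the claim fails (e.g. quadratic u_i with h ≥ 2, or an infinite initial second moment). *)

(* Defs.v *)
From HB Require Import structures.
From mathcomp Require Import all_boot all_order all_algebra.
From mathcomp Require Import all_classical all_reals all_analysis.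
From mathcomp Require Import mxtens.

Set Implicit Arguments.
Unset Strict Implicit.
Unset Printing Implicit Defensive.

Import Order.TTheory GRing.Theory Num.Theory.
Import numFieldNormedType.Exports.

Local Open Scope classical_set_scope.
Local Open Scope ring_scope.

(* The norm `|x| of the library on matrices is the max norm. *)
Definition l2norm (R : realType) (n : nat) (x : 'cV[R]_n) : R :=
  Num.sqrt (\sum_i x i 0 ^+ 2).

Definition dotv (R : realType) (n : nat) (x y : 'cV[R]_n) : R :=
  (x^T *m y) 0 0.

(* Meaningful only where [f] is differentiable, which [C1] below provides. *)
Definition grad (R : realType) (n : nat) (f : 'cV[R]_n -> R) (x : 'cV[R]_n) :
  'cV[R]_n := \col_j 'D_(delta_mx j 0) f x.

Definition C1 (R : realType) (n : nat) (f : 'cV[R]_n -> R) : Prop :=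
  (forall x, differentiable f x) /\ continuous (grad f).

Definition strongly_convex (R : realType) (n : nat) (mu : R)
    (f : 'cV[R]_n -> R) : Prop :=
  forall x y,
    mu / 2 * l2norm (x - y) ^+ 2 <= f x - f y - dotv (grad f y) (x - y).

(* Stacked vectors of R^(m d) are column vectors of length m * d whose entries
   are ordered as in the Kronecker product [*t]. *)
Definition block (R : realType) (m d : nat) (X : 'cV[R]_(m * d)) (i : 'I_m) :
  'cV[R]_d := \col_j X (mxtens_index (i, j)) 0.

Definition block_mean (R : realType) (m d : nat) (X : 'cV[R]_(m * d)) :
  'cV[R]_d := m%:R^-1 *: \sum_i block X i.

Definition consensus_error (R : realType) (m d : nat) (X : 'cV[R]_(m * d)) :
    'cV[R]_(m * d) :=
  X - ((const_mx 1 : 'cV[R]_m) *t block_mean X : 'cV[R]_(m * d)).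

Definition total_potential (R : realType) (m d : nat)
  (u : 'I_m -> 'cV[R]_d -> R) (x : 'cV[R]_d) : R := \sum_i u i x.

Definition stacked_potential (R : realType) (m d : nat)
    (u : 'I_m -> 'cV[R]_d -> R) (X : 'cV[R]_(m * d)) : R :=
  \sum_i u i (block X i).

Definition doubly_stochastic (R : realType) (m : nat) (A : 'M[R]_m) : Prop :=
  [/\ forall i j, 0 <= A i j,
      forall i, \sum_j A i j = 1 &
      forall j, \sum_i A i j = 1].

(* All the eigenvalues of [A] are in [R]; [lam] lists them with multiplicity,
   in nonincreasing order, so that [lam`_i] is the (i+1)-st largest one. *)
Definition sorted_eigenvalues (R : realType) (m : nat) (A : 'M[R]_m)
    (lam : seq R) : Prop :=
  char_poly A = \prod_(l <- lam) ('X - l%:P) /\ sorted >=%R lam.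

Definition connected_graph (m : nat) (e : rel 'I_m) : Prop :=
  symmetric e /\ forall i j, connect e i j.

Definition mixing_matrix (R : realType) (m d : nat) (A : 'M[R]_m) :
  'M[R]_(m * d) := A *t (1%:M : 'M[R]_d).

Definition stepsize (R : realType) (k : nat) : R := (1 + k%:R)^-1.

(* [X] is a path of the Euler-Maruyama scheme driven by the noise path [Z]. *)
Definition euler_maruyama (R : realType) (m d : nat) (A : 'M[R]_m)
    (u : 'I_m -> 'cV[R]_d -> R) (h sigma : R) (Z X : nat -> 'cV[R]_(m * d)) :
    Prop :=
  forall k, X k.+1 =
    ((1 - h) *: 1%:M + h *: mixing_matrix d A) *m X k
    - (stepsize R k.+1 * h) *: grad (stacked_potential u) (X k)
    + Num.sqrt (2 * sigma * stepsize R k.+1 * h) *: Z k.+1.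

(* R^n with its Borel sigma-algebra. *)
Definition borelV (R : realType) (n : nat) :=
  g_sigma_algebraType (@open 'cV[R]_n).

Definition mutually_independent (dT dE : measure_display)
    (T : measurableType dT) (E : measurableType dE) (R : realType)
    (P : probability T R) (I : choiceType) (X : I -> T -> E) : Prop :=
  forall (s : seq I) (B : I -> set E), uniq s ->
    (forall i, measurable (B i)) ->
    P (\bigcap_(i in [set` s]) X i @^-1` B i) =
    (\prod_(i <- s) P (X i @^-1` B i))%E.

Definition standard_gaussian (dT : measure_display) (T : measurableType dT)
    (R : realType) (P : probability T R) (n : nat) (Y : T -> 'cV[R]_n) : Prop :=
  [/\ measurable_fun [set: T] (Y : T -> borelV R n),
      forall j (B : set R), measurable B ->
        pushforward P (fun w => Y w j 0 : R) B = normal_prob 0 1 B &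
      mutually_independent P (fun j w => Y w j 0 : R)].

(* Joint distributions with marginals [mu] and [nu]. *)
Definition couplings (R : realType) (n : nat)
    (mu nu : set (borelV R n) -> \bar R) :
    set (probability (borelV R n * borelV R n)%type R) :=
  [set rho | forall B : set (borelV R n), measurable B ->
    rho (B `*` setT) = mu B /\ rho (setT `*` B) = nu B].

Definition wasserstein (R : realType) (n : nat) (q : R)
    (mu nu : set (borelV R n) -> \bar R) : \bar R :=
  poweR (ereal_inf
    [set (\int[rho]_z (powR (l2norm ((z.1 : 'cV[R]_n) - z.2)) q)%:E)%E
      | rho in couplings mu nu]) q^-1.

Definition error_law (dT : measure_display) (T : measurableType dT)
    (R : realType) (P : probability T R) (m d : nat)
    (X : T -> 'cV[R]_(m * d)) : set (borelV R (m * d)) -> \bar R :=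
  pushforward P (fun w => consensus_error (X w) : borelV R (m * d)).

Definition delta_origin (R : realType) (n : nat) :
    set (borelV R n) -> \bar R :=
  dirac ((0 : 'cV[R]_n) : borelV R n).

(* Main.v *)
(* Taking x = y in the heterogeneity bound on the gradients shows that all the
   grad u_i coincide with a single G-Lipschitz map, so the drift moves the
   consensus error E_k by at most alpha h G |E_k|.  On the vectors orthogonal to
   the constants, (1 - h) I + h A is a strict contraction, by the spectral
   theorem and because 0 < h (1 - lambda_i) < 2 for i >= 2.  Bounding the cross
   terms by AM-GM,
     E|E_{k+1}|^2 <= (q + C alpha_{k+1}^2) E|E_k|^2 + C' alpha_{k+1},  q < 1,
   hence E|E_k|^2 = O(1/(1+k)), and the product coupling with delta_0 gives the
   rate (1+k)^(-1/2) for W_2. *)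
Require Import Defs.
From HB Require Import structures.
From mathcomp Require Import all_boot all_order all_algebra.
From mathcomp Require Import fingroup perm complex spectral mxtens ring lra.
From mathcomp Require Import all_classical all_reals all_analysis.
From mathcomp Require Import measurable_realfun.

Import Order.TTheory GRing.Theory Num.Theory.
Import numFieldNormedType.Exports.

Local Open Scope classical_set_scope.
Local Open Scope ring_scope.

Set Implicit Arguments.
Unset Strict Implicit.

(** * Spectral gap of a symmetric stochastic matrix *)

Lemma char_poly_conj (F : fieldType) n (P D : 'M[F]_n) :
  P \in unitmx -> char_poly (invmx P *m D *m P) = char_poly D.
Proof.
move=> uP; rewrite /char_poly /char_poly_mx.
have PK : map_mx polyC (invmx P) *m map_mx polyC P = 1%:M.
  by rewrite -map_mxM mulVmx // map_mx1.
have -> : 'X%:M - map_mx polyC (invmx P *m D *m P) =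
    map_mx polyC (invmx P) *m ('X%:M - map_mx polyC D) *m map_mx polyC P.
  rewrite mulmxBr mulmxBl !map_mxM; congr (_ - _).
  by rewrite scalar_mxC -mulmxA PK mulmx1.
by rewrite !det_mulmx mulrAC -det_mulmx PK det1 mul1r.
Qed.

Lemma size_eigenvalues (F : fieldType) n (A : 'M[F]_n) (lam : seq F) :
  char_poly A = \prod_(l <- lam) ('X - l%:P) -> size lam = n.
Proof.
move=> AE; apply: succn_inj.
by rewrite -(size_prod_XsubC _ id) -AE size_char_poly.
Qed.

Section SpectralGap.
Local Open Scope sesquilinear_scope.
Variable C : numClosedFieldType.

Lemma dotcE n (v w : 'cV[C]_n) :
  (v ^t* *m w) 0 0 = \sum_i (v i 0)^* * w i 0.
Proof. by rewrite mxE; apply: eq_bigr => i _; rewrite !mxE. Qed.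

(* In the eigenbasis the fixed vector c has only an i0-coordinate, so v, being
   orthogonal to c, has none. *)
Lemma normal_diag_gap n (P : 'M[C]_n) (D : 'rV[C]_n) (i0 : 'I_n)
    (c v : 'cV[C]_n) (a b r : C) (A := invmx P *m diag_mx D *m P) :
  P \is unitarymx -> 0 <= r ->
  D 0 i0 = 1 -> (forall i, i != i0 -> D 0 i != 1) ->
  (forall i, i != i0 -> `|a + b * D 0 i| ^+ 2 <= r) ->
  A *m c = c -> c != 0 -> (c ^t* *m v) 0 0 = 0 ->
  \sum_i `|(a *: v + b *: (A *m v)) i 0| ^+ 2 <= r * \sum_i `|v i 0| ^+ 2.
Proof.
move=> uP r0 Di0 Dne Dle Acc c0 cv0.
have Pu := unitarymx_unit uP.
(* [P] is unitary, so norms and Hermitian products may be computed on the eigenbasis coordinates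
   [P *m x], where [A] is diagonal. *)
have iso (x y : 'cV[C]_n) : ((P *m x) ^t* *m (P *m y)) 0 0 = (x ^t* *m y) 0 0.
  rewrite trmx_mul map_mxM /= -mulmxA [X in _ *m X]mulmxA.
  by rewrite -(invmx_unitary uP) mulVmx // mul1mx.
have isoN (x : 'cV[C]_n) : \sum_i `|x i 0| ^+ 2 = \sum_i `|(P *m x) i 0| ^+ 2.
  transitivity ((x ^t* *m x) 0 0).
    by rewrite dotcE; apply: eq_bigr => i _; rewrite normCKC.
  by rewrite -iso dotcE; apply: eq_bigr => i _; rewrite normCKC.
have PA x : P *m (A *m x) = diag_mx D *m (P *m x).
  by rewrite /A -!mulmxA mulKVmx.
have Pc i : i != i0 -> (P *m c) i 0 = 0.
  move=> ii0; have := congr1 (fun x : 'cV_n => (P *m x) i 0) Acc.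
  rewrite /= PA mul_diag_mx [X in X = _]mxE => /eqP.
  rewrite -subr_eq0 -[X in _ - X]mul1r -mulrBl mulf_eq0 subr_eq0.
  by rewrite (negbTE (Dne _ ii0)) => /eqP.
have Pv0 : (P *m v) i0 0 = 0.
  move: cv0; rewrite -iso dotcE (bigD1 i0) //= big1 ?addr0; last first.
    by move=> i /Pc ->; rewrite conjC0 mul0r.
  move/eqP; rewrite mulf_eq0 conjC_eq0 => /orP[/eqP Pci0|/eqP //].
  case/eqP: c0; rewrite -[c](mulKmx Pu); suff -> : P *m c = 0 by rewrite mulmx0.
  apply/colP => i; rewrite [RHS]mxE; have [->//|/Pc//] := eqVneq i i0.
rewrite [leLHS]isoN [X in _ * X]isoN mulr_sumr ler_sum // => i _.
rewrite mulmxDr -!scalemxAr PA mul_diag_mx.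
rewrite [X in `|X|]mxE [X in X + _]mxE [X in _ + X]mxE [X in b * X]mxE.
have [->|ii0] := eqVneq i i0.
  by rewrite Pv0 !mulr0 addr0 normr0 expr0n /= mulr0.
by rewrite mulrA -mulrDl normrM exprMn ler_wpM2r ?exprn_ge0 ?Dle.
Qed.

End SpectralGap.

Section RealGap.
Local Open Scope sesquilinear_scope.
Variable R : rcfType.

(** The eigenvalue 1 is simple and carried by the constants. Any other eigenvalue l lies between the
    last and the second entry of [lam], so 1 - h + h l is below 1 by the gap and above -1 by the
    bound on [h]. The computation takes place over [R[i]], where a symmetric real matrix is normal
    and hence unitarily diagonalizable. *)
Lemma spectral_gap_contraction m (A : 'M[R]_m) (lam : seq R) (h : R) :
  A^T = A -> (forall i, \sum_j A i j = 1) ->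
  char_poly A = \prod_(l <- lam) ('X - l%:P) -> sorted >=%R lam ->
  lam`_0 = 1 -> lam`_1 < 1 -> 0 < h -> h * (1 - lam`_m.-1) < 2 ->
  exists2 r, 0 < r < 1 & forall v : 'cV[R]_m, \sum_i v i 0 = 0 ->
    \sum_i (((1 - h) *: v + h *: (A *m v)) i 0) ^+ 2 <= r * \sum_i v i 0 ^+ 2.
Proof.
move=> Asym Arow Achar lam_sorted lam0 lam1 h0 hm.
pose f := (real_complex R : {rmorphism R -> R[i]}).
pose Ac := map_mx f A; pose P := spectralmx Ac; pose D := spectral_diag Ac.
have size_lam := size_eigenvalues Achar.
have Anormal : Ac \is normalmx.
  apply/hermitian_normalmx/realsym_hermsym.
    apply/is_hermitianmxP; rewrite expr0 scale1r map_mx_id //.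
    by rewrite map_trmx Asym.
  by apply/mxOverP => i j; rewrite mxE; apply/complex_realP; exists (A i j).
have uP : P \is unitarymx := spectral_unitarymx _.
have AE : Ac = invmx P *m diag_mx D *m P := orthomx_spectralP Anormal.
(* Both lists are the roots, with multiplicity, of the same split characteristic polynomial, so they
   differ by a permutation [p]. *)
have : perm_eq [seq D 0 i | i <- enum 'I_m] (map f lam).
  apply: prod_XsubC_eq; rewrite big_map big_enum /=.
  transitivity (char_poly Ac); last first.
    rewrite -map_char_poly Achar map_prod_XsubC.
    by rewrite big_map.
  rewrite AE char_poly_conj ?unitarymx_unit // char_poly_trig.
    by apply: eq_bigr => i _; rewrite mxE eqxx.
  by apply: diag_mx_is_trig.
have szf : size (map f lam) == m by rewrite size_map size_lam.
move=> /(@tuple_permP _ _ _ (Tuple szf))[p pE].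
have {pE} DE i : D 0 i = f lam`_(p i).
  have : nth 0 [seq D 0 i | i <- enum 'I_m] i =
     nth 0 [tuple tnth (Tuple szf) (p i)  | i < m] i by rewrite pE.
  rewrite (nth_map i) ?size_enum_ord // nth_ord_enum => ->.
  rewrite -tnth_nth tnth_mktuple (tnth_nth 0) /= (nth_map 0) //.
  by rewrite size_lam.
(* Were [lam] empty, its first entry would be the default value 0 instead of 1. *)
have m0 : (0 < m)%N.
  rewrite -size_lam; case: (lam) lam0 => // /eqP; by rewrite /= eq_sym oner_eq0.
(* The index whose eigenvalue is the head of the sorted list, namely 1. *)
pose i0 : 'I_m := (p^-1)%g (Ordinal m0).
have lamle i : i != i0 -> lam`_m.-1 <= lam`_(p i) <= lam`_1.
  move=> ii0; have pi0 : (0 < p i)%N.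
    rewrite lt0n; apply: contra ii0 => /eqP pi0; apply/eqP.
    by rewrite /i0; apply: (perm_inj (s := p)); rewrite permKV; apply: val_inj.
  have tr : transitive (>=%R : rel R) by move=> x y z /= xy /le_trans; apply.
  have := sorted_leq_nth tr lexx 0 lam_sorted.
  have pim := ltn_ord (p i).
  move=> H; apply/andP; split; apply: H => //;
    rewrite ?inE ?size_lam ?prednK //.
    by rewrite -ltnS prednK.
  exact: leq_ltn_trans pim.
pose g i := (1 - h + h * lam`_(p i)) ^+ 2.
(* The starting value 1/2 keeps [r] positive, also when [m = 1] and the maximum has no terms. *)
pose r := \big[Num.max/2^-1]_(i | i != i0) g i.
have g1 i : i != i0 -> g i < 1.
  move=> /lamle/andP[la lb]; rewrite /g -[X in _ < X](expr1n _ 2).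
  rewrite -ltr_sqrt ?expr1n ?ltr01 // sqrtr_sqr sqrtr1 ltr_norml.
  have : h * lam`_m.-1 <= h * lam`_(p i) by rewrite ler_pM2l.
  have : h * lam`_(p i) < h * 1 by rewrite ltr_pM2l // (le_lt_trans lb).
  move: hm; rewrite mulrBr; lra.
have r1 : r < 1 by apply/bigmax_ltP; split=> //; lra.
have r0 : 0 < r by apply: (lt_le_trans _ (bigmax_ge_id _ _ _ _)); lra.
exists r; first by rewrite r0.
move=> v v0.
have normf (x : R) : `|f x| ^+ 2 = f (x ^+ 2).
  rewrite -normrX -rmorphXn /= normc_def /= expr0n /= addr0 sqrtr_sqr.
  by rewrite ger0_norm ?sqr_ge0.
have fle (x y : R) : (f x <= f y) = (x <= y) by apply: lecR.
rewrite -fle rmorphM !rmorph_sum /=.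
(* The fixed vector is the all-ones one: row sums equal to 1 make it fixed, and a zero sum of
   entries is orthogonality to it. *)
have := @normal_diag_gap _ m P D i0 (const_mx 1) (map_mx f v)
  (f (1 - h)) (f h) (f r) uP.
rewrite -AE => gap.
have -> : \sum_i f (((1 - h) *: v + h *: (A *m v)) i 0 ^+ 2) =
  \sum_i `|(f (1 - h) *: map_mx f v + f h *: (Ac *m map_mx f v)) i 0| ^+ 2.
  apply: eq_bigr => i _; rewrite -normf -map_mxM -!map_mxZ -map_mxD.
  by rewrite [in RHS]mxE.
have -> : \sum_i f (v i 0 ^+ 2) = \sum_i `|map_mx f v i 0| ^+ 2.
  by apply: eq_bigr => i _; rewrite -normf [in RHS]mxE.
apply: gap.
- by rewrite -(rmorph0 f) fle ltW.
- by rewrite DE /i0 permKV /= lam0 rmorph1.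
- move=> i /lamle/andP[_ lb]; rewrite DE -(rmorph1 f) fmorph_eq lt_eqF //.
  exact: le_lt_trans lam1.
- move=> i ii0; rewrite DE -rmorphM -rmorphD normf fle.
  by rewrite -/(g i); apply: (@le_bigmax_cond _ _ _ _ _ (fun i => i != i0) g).
- apply/colP => i; rewrite !mxE; under eq_bigr do rewrite !mxE mulr1.
  by rewrite -rmorph_sum Arow rmorph1.
- apply/eqP => /colP/(_ (Ordinal m0)); rewrite !mxE => /eqP.
  by rewrite oner_eq0.
- rewrite dotcE; under eq_bigr do rewrite !mxE conjC1 mul1r.
  by rewrite -rmorph_sum v0 rmorph0.
Qed.

End RealGap.

(** * Scalar recursions and a weighted square inequality *)

(** From some [K] on the factor is at most (1 + q)/2, and any M >= 2c/(1 - q) then satisfies (1 +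
    q)/2 M + c <= M. Taking [M] above the first K + 1 terms as well starts the induction. *)
Lemma affine_recursion_bounded (R : realType) (b : nat -> R) (q D c : R) :
  0 <= q < 1 -> 0 <= D -> 0 <= c -> (forall k, 0 <= b k) ->
  (forall k, b k.+1 <= (q + D / k.+1%:R) * b k + c) ->
  exists M, forall k, b k <= M.
Proof.
move=> /andP[q0 q1] D0 c0 b0 bS.
have q'0 : 0 < 1 - q by lra.
pose K := Num.bound (2 * D / (1 - q)).
have KP k : (K <= k)%N -> D / k.+1%:R <= (1 - q) / 2.
  move=> Kk; rewrite ler_pdivrMr ?ltr0n //.
  have : 2 * D / (1 - q) <= k.+1%:R.
    apply: le_trans (ltW (archi_boundP _)) _.
      by rewrite divr_ge0 ?mulr_ge0 // ltW.
    by rewrite ler_nat leqW.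
  rewrite ler_pdivrMr //; lra.
pose M := \big[Num.max/2 * c / (1 - q)]_(i < K.+1) b i.
have M0 : 2 * c / (1 - q) <= M by exact: bigmax_ge_id.
have MK k : (k <= K)%N -> b k <= M.
  rewrite -ltnS => kK.
  exact: (le_bigmax _ (fun i : 'I_K.+1 => b i) (Ordinal kK)).
exists M; elim=> [|k IH]; first exact: MK.
have [kK|Kk] := ltnP k K; first exact: MK.
apply: le_trans (bS k) _.
have := KP _ Kk; set e := D / _ => eq.
have : (q + e) * b k <= ((1 + q) / 2) * M.
  apply: ler_pM => //; last by lra.
  by rewrite addr_ge0 // /e divr_ge0.
move: M0; rewrite ler_pdivrMr //; lra.
Qed.

(** The rescaled sequence b_k = (1 + k) a_k has a constant forcing term [C2]. With x = 1 + k, its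
    factor is compared through q (1 + x) + C1/(1 + x) <= q x + 1 + C1, which is why [D] is taken to
    be 1 + C1. *)
Lemma contraction_decay (R : realType) (a : nat -> R) (q C1 C2 : R)
    (s := fun k : nat => (1 + k%:R)^-1 : R) :
  0 <= q < 1 -> 0 <= C1 -> 0 <= C2 -> (forall k, 0 <= a k) ->
  (forall k, a k.+1 <= (q + C1 * s k.+1 ^+ 2) * a k + C2 * s k.+1) ->
  exists M, forall k, a k <= M * s k.
Proof.
move=> q01 C10 C20 a0 aS; pose b k := a k * (1 + k%:R).
have x0 k : 0 < 1 + k%:R :> R by rewrite nat1r ltr0n.
have [||||M bM] := @affine_recursion_bounded _ b q (1 + C1) C2 q01;
  first by lra.
- by [].
- by move=> k; rewrite mulr_ge0 // ltW.
- move=> k; have := aS k.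
  rewrite -(ler_pM2r (x0 k.+1)) -/(b _) => /le_trans; apply.
  rewrite /s mulrDl [C2 / _ * _]divfK ?gt_eqF // lerD2r.
  rewrite /b -![k.+1%:R]nat1r.
  have := x0 k; have := x0 k.+1; rewrite -[k.+1%:R]nat1r.
  set x := 1 + k%:R => y0 xx0.
  rewrite [leLHS]mulrAC [a k * x]mulrC [leRHS]mulrA ler_wpM2r //.
  have -> : (q + C1 * (1 + x)^-1 ^+ 2) * (1 + x) = q * (1 + x) + C1 / (1 + x).
    by field; lra.
  have -> : (q + (1 + C1) / x) * x = q * x + 1 + C1 by field; lra.
  have : C1 / (1 + x) <= C1 by rewrite ler_pdivrMr // ler_peMr //; lra.
  move: q01; lra.
by exists M => k; rewrite /s ler_pdivlMr //; exact: bM.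
Qed.

(** The right side minus the left side is exactly e (a - (c - b)/e)^2 + (1 + 1/e) (b + c)^2. A small
    [e] keeps the coefficient of the contracted term [a] close to 1. *)
Lemma sqr_perturb_le (R : realFieldType) (a b c e : R) : 0 < e ->
  (a - b + c) ^+ 2 <= (1 + e) * a ^+ 2 + 2 * (1 + e^-1) * (b ^+ 2 + c ^+ 2).
Proof.
move=> e0.
have : 0 <= (1 + e^-1) * (b + c) ^+ 2.
  by rewrite mulr_ge0 ?sqr_ge0 // addr_ge0 // invr_ge0 ltW.
have : 0 <= e * (a - e^-1 * (c - b)) ^+ 2 by rewrite mulr_ge0 ?sqr_ge0 // ltW.
have -> : e * (a - e^-1 * (c - b)) ^+ 2 =
  e * a ^+ 2 - 2 * a * (c - b) + e^-1 * (c - b) ^+ 2 by field; rewrite gt_eqF.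
set f := e^-1; nra.
Qed.

(** * Removing the mean of a vector *)

Section Demean.
Context {R : realType} {m : nat}.
Implicit Types v w : 'cV[R]_m.

(** The orthogonal projection onto the zero-sum vectors, the complement of the constants. *)
Definition demean v : 'cV[R]_m := v - const_mx (m%:R^-1 * \sum_i v i 0).

Lemma demeanE v i : demean v i 0 = v i 0 - m%:R^-1 * \sum_i v i 0.
Proof. by rewrite !mxE. Qed.

Lemma demeanD v w : demean (v + w) = demean v + demean w.
Proof.
apply/colP => i; rewrite [RHS]mxE !demeanE mxE.
under eq_bigr do rewrite mxE.
by rewrite big_split /=; ring.
Qed.

Lemma demeanZ a v : demean (a *: v) = a *: demean v.
Proof.
apply/colP => i; rewrite [RHS]mxE !demeanE mxE.
under eq_bigr do rewrite mxE.
by rewrite -mulr_sumr; ring.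
Qed.

Lemma sum_demean v : \sum_i demean v i 0 = 0.
Proof.
under eq_bigr do rewrite demeanE.
rewrite big_split /= sumr_const card_ord -[X in _ + X]mulr_natr.
have [m0|m0] := eqVneq m 0%N; last by field; rewrite pnatr_eq0.
have sum0 (F : 'I_m -> R) : \sum_i F i = 0.
  by rewrite big1 // => i; have := ltn_ord i; rewrite {2}m0.
by rewrite !sum0 mulr0 oppr0 mul0r addr0.
Qed.

(** Row sums equal to 1 make [A] fix the constants; column sums equal to 1 make it preserve the
    mean. *)
Lemma demean_mul (A : 'M[R]_m) v :
  (forall i, \sum_j A i j = 1) -> (forall j, \sum_i A i j = 1) ->
  demean (A *m v) = A *m demean v.
Proof.
move=> Ar Ac; rewrite /demean mulmxBr; congr (_ - _).
apply/colP => i; rewrite !mxE.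
under [RHS]eq_bigr do rewrite mxE; rewrite -mulr_suml Ar mul1r; congr (_ * _).
under eq_bigr do rewrite mxE; rewrite exchange_big /=.
by apply: eq_bigr => j _; rewrite -mulr_suml Ac mul1r.
Qed.

(** The mean is the constant closest to [v]: the cross term vanishes because demeaned entries sum to
    0. The freedom in [t] allows a convenient reference value in place of the mean. *)
Lemma sum_sqr_demean_le v t :
  \sum_i demean v i 0 ^+ 2 <= \sum_i (v i 0 - t) ^+ 2.
Proof.
set a := m%:R^-1 * \sum_i v i 0.
have -> : \sum_i (v i 0 - t) ^+ 2 =
    \sum_i demean v i 0 ^+ 2 + (2 * (a - t)) * (\sum_i demean v i 0)
      + \sum_(i < m) (a - t) ^+ 2.
  rewrite mulr_sumr -!big_split /=; apply: eq_bigr => i _.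
  by rewrite demeanE -/a; ring.
by rewrite sum_demean mulr0 addr0 lerDl sumr_ge0 // => i _; rewrite sqr_ge0.
Qed.

End Demean.

(** * Stacked vectors, by agent and by coordinate, and one step of the scheme *)

Section Stacked.
Context {R : realType} {m d : nat}.
Implicit Types X : 'cV[R]_(m * d).

Lemma sum_mxtens (V : nmodType) (F : 'I_(m * d) -> V) :
  \sum_k F k = \sum_i \sum_j F (mxtens_index (i, j)).
Proof.
rewrite pair_bigA /= (reindex (@mxtens_index m d)) /=.
  by apply: eq_bigr => -[].
by exists (@mxtens_unindex m d) => k _; rewrite ?mxtens_indexK ?mxtens_unindexK.
Qed.

(** Complementary to [block]: the coordinate is fixed and the agent varies. The mixing matrix acts
    on each slice as [A], so the spectral gap in dimension [m] applies slice by slice. *)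
Definition slice X j : 'cV[R]_m := \col_i X (mxtens_index (i, j)) 0.

Lemma l2norm_sqr n (x : 'cV[R]_n) : l2norm x ^+ 2 = \sum_i x i 0 ^+ 2.
Proof. by rewrite sqr_sqrtr // sumr_ge0 // => i _; rewrite sqr_ge0. Qed.

Lemma l2norm_sqr_slice X :
  l2norm X ^+ 2 = \sum_j \sum_i slice X j i 0 ^+ 2.
Proof.
rewrite l2norm_sqr sum_mxtens exchange_big /=.
by apply: eq_bigr => j _; apply: eq_bigr => i _; rewrite !mxE.
Qed.

Lemma l2norm_sqr_block X :
  l2norm X ^+ 2 = \sum_i l2norm (block X i) ^+ 2.
Proof.
rewrite l2norm_sqr sum_mxtens.
apply: eq_bigr => i _; rewrite l2norm_sqr.
by apply: eq_bigr => j _; rewrite !mxE.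
Qed.

Lemma slice_consensus_error X j :
  slice (consensus_error X) j = demean (slice X j).
Proof.
apply/colP => i; rewrite demeanE !mxE !mxtens_indexK /= ?mxE mul1r summxE.
by congr (_ - _ * _); apply: eq_bigr => k _; rewrite !mxE.
Qed.

Lemma block_consensus_error X i :
  block (consensus_error X) i = block X i - block_mean X.
Proof.
apply/colP => j; rewrite !mxE !mxtens_indexK /= ?mxE mul1r !summxE.
by congr (_ - _ * _); apply: eq_bigr => k _; rewrite !mxE.
Qed.

Lemma slice_mixing (A : 'M[R]_m) X j :
  slice (mixing_matrix d A *m X) j = A *m slice X j.
Proof.
apply/colP => i; rewrite !mxE sum_mxtens; apply: eq_bigr => k _.
rewrite (bigD1 j) //= big1 ?addr0 => [|l lj].
  by rewrite tensmxE !mxE eqxx mulr1.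
by rewrite tensmxE !mxE eq_sym (negbTE lj) mulr0 mul0r.
Qed.

Lemma sliceD X Y j : slice (X + Y) j = slice X j + slice Y j.
Proof. by apply/colP => i; rewrite !mxE. Qed.

Lemma sliceZ a X j : slice (a *: X) j = a *: slice X j.
Proof. by apply/colP => i; rewrite !mxE. Qed.

Lemma blockD X Y i : block (X + Y) i = block X i + block Y i.
Proof. by apply/colP => j; rewrite !mxE. Qed.

Lemma blockZ a X i : block (a *: X) i = a *: block X i.
Proof. by apply/colP => j; rewrite !mxE. Qed.

Lemma grad_stacked_potential (u : 'I_m -> 'cV[R]_d -> R) X i :
  (forall i x, differentiable (u i) x) ->
  block (grad (stacked_potential u) X) i = grad (u i) (block X i).
Proof.
move=> du; apply/colP => j; rewrite !mxE.
set v := delta_mx _ _.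
(* The difference quotients along [v] are those of [u k] along [block v k], so derivability and
   derivatives transfer directly; only the block [i] of [v] is nonzero. *)
have quot k :
    (fun h : R => h^-1 *: (((fun Y => u k (block Y k)) \o shift X) (h *: v)
      - u k (block X k))) =
    (fun h : R => h^-1 *: ((u k \o shift (block X k)) (h *: block v k)
      - u k (block X k))).
  by apply/funext => h /=; rewrite blockD blockZ.
have -> : stacked_potential u = \sum_(k < m) (fun Y => u k (block Y k)).
  by apply/funext => Y; rewrite fct_sumE.
rewrite derive_sum; last first.
  move=> k; rewrite /derivable quot; exact: diff_derivable.
have dE k : 'D_v (fun Y => u k (block Y k)) X =
  'D_(block v k) (u k) (block X k).
  by rewrite /derive quot.
rewrite (bigD1 i) //= big1 ?addr0 => [|k ki].
  rewrite dE; congr (derive _ _ _).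
  apply/colP => l; rewrite !mxE eqxx !andbT; congr (_%:R); congr nat_of_bool.
  by rewrite (can_eq (@mxtens_indexK _ _)) xpair_eqE eqxx.
rewrite dE deriveE //; suff -> : block v k = 0 by rewrite linear0.
apply/colP => l; rewrite !mxE (can_eq (@mxtens_indexK _ _)) xpair_eqE.
by rewrite (negbTE ki).
Qed.

(** A pathwise estimate. On each demeaned slice the linear part contracts by [gap], while the drift
    and the noise are perturbations, separated from it by [sqr_perturb_le]. *)
Lemma consensus_error_step (A : 'M[R]_m) (u : 'I_m -> 'cV[R]_d -> R)
    (G h s c r e : R) (X X' Z : 'cV[R]_(m * d)) :
  (0 < m)%N ->
  (forall i, \sum_j A i j = 1) -> (forall j, \sum_i A i j = 1) ->
  (forall i x, differentiable (u i) x) ->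
  (forall i j x y,
     l2norm (grad (u i) x - grad (u j) y) <= G * l2norm (x - y)) ->
  (forall v : 'cV[R]_m, \sum_i v i 0 = 0 ->
    \sum_i (((1 - h) *: v + h *: (A *m v)) i 0) ^+ 2 <=
      r * \sum_i v i 0 ^+ 2) ->
  0 < e ->
  X' = ((1 - h) *: 1%:M + h *: mixing_matrix d A) *m X
    - (s * h) *: grad (stacked_potential u) X + c *: Z ->
  l2norm (consensus_error X') ^+ 2 <=
    ((1 + e) * r + 2 * (1 + e^-1) * (s * h * G) ^+ 2)
      * l2norm (consensus_error X) ^+ 2
    + 2 * (1 + e^-1) * c ^+ 2 * l2norm Z ^+ 2.
Proof.
move=> m0 Ar Ac du hG gap e0 X'E.
set g := grad (stacked_potential u) X in X'E *.
(* One reference gradient for all agents: [hG], used with two different indices, bounds the distance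
   of each agent's gradient to [t] by [G] times its distance to the mean. *)
pose t := grad (u (Ordinal m0)) (block_mean X).
have gt : \sum_j \sum_i (demean (slice g j) i 0) ^+ 2 <=
  G ^+ 2 * l2norm (consensus_error X) ^+ 2.
  apply: (@le_trans _ _ (\sum_j \sum_i (slice g j i 0 - t j 0) ^+ 2)).
    by apply: ler_sum => j _; exact: sum_sqr_demean_le.
  rewrite exchange_big l2norm_sqr_block mulr_sumr; apply: ler_sum => i _.
  rewrite block_consensus_error -exprMn.
  have := hG i (Ordinal m0) (block X i) (block_mean X).
  rewrite -(grad_stacked_potential _ _ du) -/g -/t => lipG.
  (* Squaring requires a nonnegative right side, which holds because [lipG] bounds a norm by it. *)
  have : l2norm (block g i - t) ^+ 2 <=
    (G * l2norm (block X i - block_mean X)) ^+ 2.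
    by rewrite ler_pXn2r ?nnegrE // ?sqrtr_ge0 // (le_trans _ lipG) //
      sqrtr_ge0.
  by apply: le_trans; rewrite l2norm_sqr; apply: ler_sum => j _; rewrite !mxE.
have zt : \sum_j \sum_i (demean (slice Z j) i 0) ^+ 2 <= l2norm Z ^+ 2.
  rewrite l2norm_sqr_slice; apply: ler_sum => j _.
  by apply: le_trans (sum_sqr_demean_le _ 0) _; under eq_bigr do rewrite subr0.
pose lin j := (1 - h) *: demean (slice X j) + h *: (A *m demean (slice X j)).
have stepE j : demean (slice X' j) = lin j
    - (s * h) *: demean (slice g j) + c *: demean (slice Z j).
  rewrite X'E mulmxDl -!scalemxAl mul1mx -scaleNr !sliceD !sliceZ slice_mixing.
  by rewrite !demeanD !demeanZ demean_mul // scaleNr.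
have {}gap : \sum_j \sum_i (lin j i 0) ^+ 2
   <= r * l2norm (consensus_error X) ^+ 2.
  rewrite l2norm_sqr_slice mulr_sumr; apply: ler_sum => j _.
  by rewrite slice_consensus_error; apply: gap; rewrite sum_demean.
rewrite l2norm_sqr_slice.
apply: (@le_trans _ _ (\sum_j \sum_i ((1 + e) * (lin j i 0) ^+ 2
  + 2 * (1 + e^-1) * ((s * h) ^+ 2 * (demean (slice g j) i 0) ^+ 2
    + c ^+ 2 * (demean (slice Z j) i 0) ^+ 2)))).
  apply: ler_sum => j _; apply: ler_sum => i _.
  rewrite slice_consensus_error stepE -!exprMn.
  rewrite [X in X ^+ 2]mxE [X in (X + _) ^+ 2]mxE [X in (_ + X + _) ^+ 2]mxE.
  rewrite [X in (_ - X + _) ^+ 2]mxE [X in (_ + X) ^+ 2 <= _]mxE.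
  exact: sqr_perturb_le.
under eq_bigr => j _ do rewrite big_split -!mulr_sumr big_split -!mulr_sumr /=.
rewrite big_split -!mulr_sumr big_split -!mulr_sumr /=.
have f0 : 0 < e^-1 by rewrite invr_gt0.
have := ler_wpM2l (sqr_ge0 (s * h)) gt.
have := ler_wpM2l (sqr_ge0 c) zt.
move: gap; move: (\sum_j _) (\sum_j _) (\sum_j _) (e^-1) f0.
move: (l2norm _ ^+ 2) (l2norm _ ^+ 2) => N M a b z f f0 ha hz hb.
have := ler_wpM2l (ltW (addr_gt0 ltr01 e0)) ha.
have := ler_wpM2l (ltW (addr_gt0 ltr01 f0)) (lerD hb hz).
rewrite [(s * h * G) ^+ 2]exprMn; lra.
Qed.

End Stacked.

(** * Borel measurability of vector-valued maps *)

Section BorelVectors.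
Context {R : realType} {n : nat}.

Lemma continuous_measurable_borelV (f : 'cV[R]_n -> R) :
  continuous f -> measurable_fun [set: borelV R n] (f : borelV R n -> R).
Proof.
move=> /continuousP cf; apply: (measurability _ (RGenOpens.measurableE R)).
move=> _ [_ [a [b ->] <-]]; rewrite setTI; apply: sub_sigma_algebra.
by apply: cf; exact: interval_open.
Qed.

Lemma measurable_borelV d (T : measurableType d) (f : T -> 'cV[R]_n) :
  (forall j, measurable_fun setT (fun w => f w j 0)) ->
  measurable_fun setT (f : T -> borelV R n).
Proof.
move=> mf.
apply: (@measurability _ _ _ (borelV R n) _ _ (@open 'cV[R]_n)) => //.
move=> _ [U oU <-]; rewrite setTI.
(* U is the union of the countably many rational boxes that it contains. *)
pose itv (q : rat) (k : nat) : interval R :=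
  `]ratr q - k.+1%:R^-1, ratr q + k.+1%:R^-1[.
pose box (p : {ffun 'I_n -> rat} * nat) : set 'cV[R]_n :=
  [set x | forall j, x j 0 \in itv (p.1 j) p.2].
have mbox p : measurable (f @^-1` box p).
  have -> : f @^-1` box p = \bigcap_(j in [set: 'I_n])
      ((fun w => f w j 0) @^-1` [set` itv (p.1 j) p.2]).
    by apply/seteqP; split => w /= wb j; [move=> _|]; exact: wb.
  apply: fin_bigcap_measurable => // j _.
  by rewrite -[X in measurable X]setTI; exact: mf.
have -> : f @^-1` U = \bigcup_(p in [set p | box p `<=` U]) (f @^-1` box p).
  apply/seteqP; split => [w /= Uw|w [p /= pU] /pU //].
  have /nbhs_ballP[e /= e0 eU] : nbhs (f w) U by exact: open_nbhs_nbhs.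
  have [k ke'] : exists k, 2 / e < k%:R.
    exists (Num.bound (2 / e)); apply: archi_boundP.
    by rewrite divr_ge0 // ltW.
  have k0 : 0 < k.+1%:R^-1 :> R by rewrite invr_gt0 ltr0n.
  (* Two points of one box differ by less than 2/(k + 1) in every coordinate, so a box of this size
     containing [f w] stays inside the ball of radius [e]. *)
  have ke : 2 * k.+1%:R^-1 < e.
    rewrite ltr_pdivrMr ?ltr0n // mulrC -ltr_pdivrMr //.
    by apply: lt_le_trans ke' _; rewrite ler_nat.
  have near j : exists q : rat, f w j 0 \in itv q k.
    have : f w j 0 - k.+1%:R^-1 < f w j 0 + k.+1%:R^-1.
      by rewrite ltrBlDr -addrA ltrDl addr_gt0.
    move=> /rat_in_itvoo[q].
    rewrite in_itv /= => /andP[q1 q2]; exists q.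
    by rewrite in_itv /= ltrBlDr q2 -ltrBlDr q1.
  have [c cP] := choice near.
  exists ([ffun j => c j], k) => /=; last by move=> j /=; rewrite ffunE.
  move=> y /= yb; apply: eU; split=> // i j; rewrite (ord1 j) /ball /=.
  have := yb i; have := cP i; rewrite ffunE !in_itv /= ltr_norml.
  move: ke; rewrite /=; move: (ratr _) (_^-1) (f w i 0) (y i 0) => a b x z be.
  by move=> /andP[? ?] /andP[? ?]; apply/andP; split; lra.
rewrite bigcup_mkcond; apply: countable_bigcupT_measurable => [|p].
  exact: countableP.
by case: ifP.
Qed.

Lemma measurable_coord d (T : measurableType d) (f : T -> 'cV[R]_n) j :
  measurable_fun setT (f : T -> borelV R n) ->
  measurable_fun setT (fun w => f w j 0).
Proof.
move=> mf; pose coord (x : 'cV[R]_n) := x j 0.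
apply: (measurableT_comp (continuous_measurable_borelV (f := coord) _) mf).
exact: coord_continuous.
Qed.

Lemma measurable_l2norm_sqr d (T : measurableType d) (f : T -> 'cV[R]_n) :
  measurable_fun setT (f : T -> borelV R n) ->
  measurable_fun setT (fun w => l2norm (f w) ^+ 2).
Proof.
move=> mf.
have -> : (fun w => l2norm (f w) ^+ 2) = (fun w => \sum_i f w i 0 ^+ 2).
  by apply/funext => w; rewrite l2norm_sqr.
apply: measurable_sum => i; apply: measurable_funX;
  exact: (measurable_coord _ mf).
Qed.

End BorelVectors.

(** * Distance to the Dirac mass at the origin *)

Section Wasserstein.
Context {R : realType} {n : nat} {d} {T : measurableType d}
  (P : probability T R).

(** The law of [(f w, 0)] under [P] is a coupling whose cost is the second moment of [f], and the
    infimum lies below it. *)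
Lemma wasserstein_dirac0_le (f : T -> 'cV[R]_n) :
  measurable_fun setT (f : T -> borelV R n) ->
  (wasserstein 2 (pushforward P (f : T -> borelV R n)) (@delta_origin R n) <=
   poweR (\int[P]_w (l2norm (f w) ^+ 2)%:E) 2^-1)%E.
Proof.
move=> mf.
pose F : T -> (borelV R n * borelV R n)%type := fun w => (f w, 0 : 'cV[R]_n).
have mF : measurable_fun setT F.
  by apply: measurable_fun_pair => //; exact: measurable_cst.
pose X : {mfun T >-> (borelV R n * borelV R n)%type} :=
  HB.pack F (isMeasurableFun.Build _ _ _ _ _ mF).
have cost_ge0 (z : borelV R n * borelV R n) :
    (0 <= (powR (l2norm ((z.1 : 'cV[R]_n) - z.2)) 2)%:E)%E.
  by rewrite lee_fin powR_ge0.
rewrite /wasserstein; apply: gt0_ler_poweR.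
- by rewrite invr_ge0.
- rewrite in_itv /= leey andbT; apply/ereal_infP => _ [rho _ <-].
  by apply: integral_ge0 => z _.
- rewrite in_itv /= leey andbT; apply: integral_ge0 => w _.
  by rewrite lee_fin sqr_ge0.
apply: ereal_inf_lbound; exists (distribution P X).
  move=> B mB; rewrite /distribution /= /pushforward; split.
    by congr (P _); apply/seteqP; split => w //= [].
  rewrite /delta_origin diracE; have [B0|B0] := boolP (_ \in B).
    rewrite -[RHS](probability_setT P); congr (P _).
    by apply/seteqP; split => // w _; split => //; exact: set_mem.
  rewrite -[RHS](measure0 P); congr (P _).
  by apply/seteqP; split => // w [_ /mem_set]; apply/negP.
rewrite ge0_integral_distribution //=.
  by apply: eq_integral => w _ /=; rewrite subr0 powR_mulrn // sqrtr_ge0.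
apply/measurable_EFinP.
have -> : (fun z : borelV R n * borelV R n =>
  powR (l2norm ((z.1 : 'cV[R]_n) - z.2)) 2) =
    (fun z => l2norm ((z.1 : 'cV[R]_n) - z.2) ^+ 2).
  by apply/funext => z; rewrite powR_mulrn // sqrtr_ge0.
apply: measurable_l2norm_sqr; apply: measurable_borelV => j.
have -> : (fun w : borelV R n * borelV R n => ((w.1 : 'cV[R]_n) - w.2) j 0) =
   (fun w => (w.1 : 'cV[R]_n) j 0 - (w.2 : 'cV[R]_n) j 0).
  by apply/funext => w; rewrite !mxE.
by apply: measurable_funB; apply: measurable_coord.
Qed.

Lemma wasserstein_ge0 q (mu nu : set (borelV R n) -> \bar R) :
  (0 <= wasserstein q mu nu)%E.
Proof. exact: poweR_ge0. Qed.

End Wasserstein.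

(** * Second moment of the standard normal law *)

Section Gaussian.
Context {R : realType}.
Local Notation leb := (@lebesgue_measure R).

(** The Radon-Nikodym derivative and [normal_pdf] have the same integral over every measurable set,
    hence agree almost everywhere. *)
Lemma ge0_integral_normal_prob (m s : R) (f : R -> \bar R) :
  measurable_fun setT f -> (forall x, 0 <= f x)%E ->
  (\int[normal_prob m s]_x f x = \int[leb]_x (f x * (normal_pdf m s x)%:E))%E.
Proof.
move=> mf f0; pose dom := normal_prob_dominates m s.
have mpdf : measurable_fun setT (fun x => (normal_pdf m s x)%:E).
  by apply/measurable_EFinP; exact: measurable_normal_pdf.
rewrite -(Radon_Nikodym_SigmaFinite.change_of_variables dom) //.
pose g := Radon_Nikodym_SigmaFinite.f (normal_prob m s) leb.
have ig : leb.-integrable setT g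
  by exact: Radon_Nikodym_SigmaFinite.f_integrable.
apply: ge0_ae_eq_integral => //.
- by apply: emeasurable_funM => //; exact: measurable_int ig.
- exact: emeasurable_funM.
- by move=> x _; rewrite mule_ge0 // Radon_Nikodym_SigmaFinite.f_ge0.
- by move=> x _; rewrite mule_ge0 // lee_fin normal_pdf_ge0.
apply: ae_eqe_mul2l; apply: integral_ae_eq => // E _ mE.
by rewrite -Radon_Nikodym_SigmaFinite.f_integral.
Qed.

Lemma normal_prob_second_moment :
  (\int[normal_prob (0 : R) 1]_x (x ^+ 2)%:E < +oo)%E.
Proof.
rewrite ge0_integral_normal_prob; first last.
- by move=> x; rewrite lee_fin sqr_ge0.
- by apply/measurable_EFinP; exact: measurable_funX.
(* x^2 e^(-x^2/2) <= 8/3 e^(-x^2/8), a multiple of the density of deviation 2 *)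
pose K : R := 8 / 3 * normal_peak 1 / normal_peak 2.
have p0 : 0 < normal_peak (2 : R) by apply: normal_peak_gt0; rewrite pnatr_eq0.
have K0 : 0 <= K by rewrite !mulr_ge0 ?invr_ge0 ?normal_peak_ge0.
apply: (@le_lt_trans _ _ (\int[leb]_x (K%:E * (normal_pdf 0 2 x)%:E))%E).
  apply: ge0_le_integral => //.
  - by move=> x _; rewrite mule_ge0 // lee_fin ?sqr_ge0 ?normal_pdf_ge0.
  - apply: emeasurable_funM; apply/measurable_EFinP;
    last exact: measurable_normal_pdf.
    exact: measurable_funX.
  - apply: emeasurable_funM => //; apply/measurable_EFinP;
    exact: measurable_normal_pdf.
  move=> x _; rewrite -!EFinM lee_fin !normal_pdfE ?oner_eq0 ?pnatr_eq0 //
    /normal_fun.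
  rewrite subr0 expr1n.
  (* The split 1/2 = 3/8 + 1/8 leaves the exponent of deviation 2; the other factor absorbs x^2
     through 1 + y <= e^y at y = 3/8 x^2. *)
  have -> : expR (- x ^+ 2 / (1 *+ 2)) =
    expR (- (3 / 8 * x ^+ 2)) * expR (- x ^+ 2 / (2 ^+ 2 *+ 2)).
    by rewrite -expRD; congr expR; field.
  have key : x ^+ 2 * expR (- (3 / 8 * x ^+ 2)) <= 8 / 3.
    rewrite expRN ler_pdivrMr ?expR_gt0 //.
    have : 1 + 3 / 8 * x ^+ 2 <= expR (3 / 8 * x ^+ 2) by exact: expR_ge1Dx.
    lra.
  move: key; set E := expR _; set F := expR _ => key.
  have -> : x ^+ 2 * (normal_peak 1 * (E * F)) =
    x ^+ 2 * E * (normal_peak 1 * F) by ring.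
  have -> : K * (normal_peak 2 * F) = 8 / 3 * (normal_peak 1 * F).
    by rewrite /K; field; rewrite gt_eqF.
  by rewrite ler_wpM2r // mulr_ge0 ?normal_peak_ge0 ?expR_ge0.
rewrite ge0_integralZl //.
- by rewrite integral_normal_pdf mule1 ltry.
- by apply/measurable_EFinP; exact: measurable_normal_pdf.
- by move=> x _; rewrite lee_fin normal_pdf_ge0.
Qed.

End Gaussian.

(** * Measurability and noise moments along the scheme *)

Section Dynamics.
Context {R : realType} {m d : nat} {dT : measure_display}
  {T : measurableType dT}
  (P : probability T R).
Implicit Types X Z : T -> 'cV[R]_(m * d).

Lemma measurable_block X i :
  measurable_fun setT (X : T -> borelV R (m * d)) ->
  measurable_fun setT ((fun w => block (X w) i) : T -> borelV R d).
Proof.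
move=> mX; apply: measurable_borelV => j.
have -> : (fun w => block (X w) i j 0) = (fun w => X w (mxtens_index (i, j)) 0).
  by apply/funext => w; rewrite mxE.
exact: (measurable_coord _ mX).
Qed.

Lemma measurable_blocks X :
  (forall i,
    measurable_fun setT ((fun w => block (X w) i) : T -> borelV R d)) ->
  measurable_fun setT (X : T -> borelV R (m * d)).
Proof.
move=> mX; apply: measurable_borelV => p; case: (mxtens_indexP p) => i j.
have -> : (fun w => X w (mxtens_index (i, j)) 0) = (fun w => block (X w) i j 0).
  by apply/funext => w; rewrite mxE.
exact: (measurable_coord _ (mX i)).
Qed.

Lemma measurable_consensus_error X :
  measurable_fun setT (X : T -> borelV R (m * d)) ->
  measurable_fun setT
    ((fun w => consensus_error (X w)) : T -> borelV R (m * d)).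
Proof.
move=> mX; apply: measurable_borelV => p; case: (mxtens_indexP p) => i j.
have -> : (fun w => consensus_error (X w) (mxtens_index (i, j)) 0) =
    (fun w => X w (mxtens_index (i, j)) 0
      - m%:R^-1 * \sum_k X w (mxtens_index (k, j)) 0).
  apply/funext => w; have := slice_consensus_error (X w) j => /colP/(_ i).
  rewrite demeanE !mxE => ->; congr (_ - _ * _).
  by apply: eq_bigr => k _; rewrite mxE.
apply: measurable_funB; first exact: (measurable_coord _ mX).
apply: measurable_funM => //; apply: measurable_sum => k.
exact: (measurable_coord _ mX).
Qed.

(** Each entry of the drift is a partial derivative of a single [u i] at a single block, continuous
    by [C1]. *)
Lemma measurable_step (B : 'M[R]_(m * d)) (u : 'I_m -> 'cV[R]_d -> R)
    (a c : R) X Z :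
  (forall i, C1 (u i)) ->
  measurable_fun setT (X : T -> borelV R (m * d)) ->
  measurable_fun setT (Z : T -> borelV R (m * d)) ->
  measurable_fun setT
    ((fun w => B *m X w - a *: grad (stacked_potential u) (X w) + c *: Z w)
      : T -> borelV R (m * d)).
Proof.
move=> hu mX mZ; apply: measurable_borelV => p; case: (mxtens_indexP p) => i j.
set p' := mxtens_index (i, j); pose dj x := grad (u i) x j 0.
have -> : (fun w => (B *m X w - a *: grad (stacked_potential u) (X w)
      + c *: Z w) p' 0) =
   (fun w => \sum_q B p' q * X w q 0 - a * dj (block (X w) i) + c * Z w p' 0).
  apply/funext => w; rewrite /dj.
  by rewrite -(grad_stacked_potential _ _ (fun i => (hu i).1)) !mxE.
apply: measurable_funD; first apply: measurable_funB.
- apply: measurable_sum => q; apply: measurable_funM => //.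
  exact: (measurable_coord _ mX).
- apply: measurable_funM => //.
  apply: (measurableT_comp (continuous_measurable_borelV (f := dj) _)
    (measurable_block i mX)).
  move=> x; apply: (@continuous_comp _ _ _ (grad (u i)) (fun y => y j 0)).
    exact: (hu i).2.
  exact: coord_continuous.
- by apply: measurable_funM => //; exact: (measurable_coord _ mZ).
Qed.

Lemma integral_sqr_standard_normal (f : T -> R) :
  measurable_fun setT f ->
  (forall B : set R, measurable B -> pushforward P f B = normal_prob 0 1 B) ->
  (\int[P]_w (f w ^+ 2)%:E = \int[normal_prob (0 : R) 1]_x (x ^+ 2)%:E)%E.
Proof.
move=> mf fN.
pose F : {mfun T >-> measurableTypeR R} :=
  HB.pack f (isMeasurableFun.Build _ _ T (measurableTypeR R) f mf).
have := @ge0_integral_distribution _ _ _ _ _ P F (fun x => (x ^+ 2)%:E).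
move=> <-.
- apply: (@eq_measure_integral _ _ _ setT (normal_prob 0 1)
    (distribution P F)) => B mB _.
  exact: fN.
- by apply/measurable_EFinP; exact: measurable_funX.
- by move=> x; rewrite lee_fin sqr_ge0.
Qed.

(** The squared norm is a sum of squared entries, each with the standard normal second moment; [V]
    is therefore the same at all times. *)
Lemma gaussian_blocks_second_moment :
  exists2 V : R, 0 <= V & forall Z : T -> 'cV[R]_(m * d),
    (forall i, standard_gaussian P (fun w => block (Z w) i)) ->
    (\int[P]_w (l2norm (Z w) ^+ 2)%:E = V%:E)%E.
Proof.
pose V0 := (\int[normal_prob (0 : R) 1]_x (x ^+ 2)%:E)%E.
have V0ge : (0 <= V0)%E by apply: integral_ge0 => x _; rewrite lee_fin sqr_ge0.
have V0fin : V0 \is a fin_num.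
  by rewrite ge0_fin_numE // normal_prob_second_moment.
exists (\sum_(p < m * d) fine V0).
  by rewrite sumr_ge0 // => p _; exact: fine_ge0.
move=> Z gZ.
have mZ : measurable_fun setT (Z : T -> borelV R (m * d)).
  by apply: measurable_blocks => i; have [] := gZ i.
under eq_integral do rewrite l2norm_sqr -sumEFin.
rewrite ge0_integral_sum //.
- rewrite -sumEFin; apply: eq_bigr => p _; rewrite fineK //.
  apply: integral_sqr_standard_normal; first exact: (measurable_coord _ mZ).
  move=> B mB; case: (mxtens_indexP p) => i j; have [_ gN _] := gZ i.
  rewrite -(gN j) //; congr (pushforward P _ B).
  by apply/funext => w; rewrite mxE.
- move=> p; apply/measurable_EFinP; apply: measurable_funX.
  exact: (measurable_coord _ mZ).
- by move=> p w _; rewrite lee_fin sqr_ge0.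
Qed.

End Dynamics.

(** Finiteness propagates from [a 0] along the recursion, which reduces the claim to real
    sequences. *)
Lemma ereal_contraction_decay (R : realType) (a : nat -> \bar R) (q C1 C2 : R)
    (s := fun k : nat => (1 + k%:R)^-1 : R) :
  0 <= q < 1 -> 0 <= C1 -> 0 <= C2 ->
  (forall k, 0 <= a k)%E -> (a 0%N < +oo)%E ->
  (forall k, a k.+1 <= (q + C1 * s k.+1 ^+ 2)%:E * a k + (C2 * s k.+1)%:E)%E ->
  exists2 M : R, 0 <= M & forall k, (a k <= (M * s k)%:E)%E.
Proof.
move=> q01 C10 C20 a0 a0fin aS.
have afin k : a k \is a fin_num.
  elim: k => [|k IH]; first by rewrite ge0_fin_numE.
  rewrite ge0_fin_numE //; apply: le_lt_trans (aS k) _.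
  by rewrite -(fineK IH) -EFinM -EFinD ltry.
have [|k|M aM] :=
  @contraction_decay _ (fun k => fine (a k)) q C1 C2 q01 C10 C20.
- by move=> k; exact: fine_ge0.
- rewrite -lee_fin EFinD EFinM !fineK //; exact: aS.
exists M; last by move=> k; rewrite -(fineK (afin k)) lee_fin aM.
by have := aM 0%N; rewrite addr0 invr1 mulr1; apply: le_trans; exact: fine_ge0.
Qed.

(** * Convergence of the consensus error in W_2 *)

Unset Implicit Arguments.

Theorem theorem2p2 (R : realType) (m d : nat)
  (e : rel 'I_m) (A : 'M[R]_m) (lam : seq R)
  (he : connected_graph e)
  (hAe : forall i j, (A i j != 0) = e i j)
  (hAsym : A^T = A) (hAds : doubly_stochastic A)
  (hlam : sorted_eigenvalues A lam)
  (hlam1 : lam`_0 = 1) (hlam2 : lam`_1 < 1) (hlamm : 0 <= lam`_m.-1)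
  (u : 'I_m -> 'cV[R]_d -> R) (L mu G : R)
  (hu : forall i, C1 (u i))
  (hL : forall x y,
     l2norm (grad (total_potential u) x - grad (total_potential u) y)
       <= L * l2norm (x - y))
  (hmu : 0 < mu) (hconv : strongly_convex mu (total_potential u))
  (hG : forall i j x y,
     l2norm (grad (u i) x - grad (u j) y) <= G * l2norm (x - y))
  (dT : measure_display) (T : measurableType dT) (P : probability T R)
  (sigma h : R) (hsigma : 0 < sigma) (hh : 0 < h)
  (hstable : h * (1 - lam`_m.-1) < 2)
  (Z X : nat -> T -> 'cV[R]_(m * d))
  (hZgauss : forall k i, standard_gaussian P (fun w => block (Z k.+1 w) i))
  (hZind : mutually_independent P
     (fun (a : nat * 'I_m) w => block (Z a.1.+1 w) a.2 : borelV R d))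
  (hX0 : measurable_fun [set: T] (X 0%N : T -> borelV R (m * d)))
  (hX0fin : (\int[P]_w (l2norm (consensus_error (X 0%N w)) ^+ 2)%:E < +oo)%E)
  (hX : forall w, euler_maruyama A u h sigma (Z ^~ w) (X ^~ w)) :
  ((fun k => wasserstein 2 (error_law P (X k)) (@delta_origin R (m * d)))
     @ \oo --> (0 : \bar R)%E) /\
  (forall gamma : R, 0 < gamma ->
     exists C : R, forall k : nat,
       (wasserstein 2 (error_law P (X k)) (@delta_origin R (m * d))
          <= (C / powR (1 + k%:R) (2^-1 - gamma))%:E)%E).
Proof.
pose a k := (\int[P]_w (l2norm (consensus_error (X k w)) ^+ 2)%:E)%E.
have mZ k : measurable_fun setT (Z k.+1 : T -> borelV R (m * d)).
  by apply: measurable_blocks => i; have [] := hZgauss k i.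
have mX k : measurable_fun setT (X k : T -> borelV R (m * d)).
  elim: k => [//|k IH].
  have -> : X k.+1 = (fun w =>
      ((1 - h) *: 1%:M + h *: mixing_matrix d A) *m X k w
    - (stepsize R k.+1 * h) *: grad (stacked_potential u) (X k w)
    + Num.sqrt (2 * sigma * stepsize R k.+1 * h) *: Z k.+1 w).
    by apply/funext => w; exact: hX.
  exact: measurable_step.
have mE k := measurable_consensus_error (mX k).
have [A0 Arow Acol] := hAds; have [lamE lam_sorted] := hlam.
have m0 : (0 < m)%N.
  rewrite -(size_eigenvalues lamE).
  by case: (lam) hlam1 => [/= /eqP|//]; rewrite eq_sym oner_eq0.
have [r /andP[r0 r1] gap] :=
  spectral_gap_contraction hAsym Arow lamE lam_sorted hlam1 hlam2 hh hstable.
have [V V0 hV] := @gaussian_blocks_second_moment R m d _ _ P.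
(* This choice gives (1 + e') r = r + r (1 - r)/2 < 1. *)
pose e' := (1 - r) / 2.
have e0 : 0 < e' by rewrite /e'; lra.
have f0 : 0 < e'^-1 by rewrite invr_gt0.
have K0 : 0 <= 2 * (1 + e'^-1) by lra.
have H0 : 0 <= 2 * sigma * h by rewrite !mulr_ge0 // ltW.
pose q := (1 + e') * r.
(* [D1] and [D2] are the drift and noise constants with the step sizes taken out: the drift
   contributes alpha^2, the noise only alpha, since its amplitude is a square root. *)
pose D1 := 2 * (1 + e'^-1) * (h * G) ^+ 2.
pose D2 := 2 * (1 + e'^-1) * (2 * sigma * h) * V.
have s0 k : 0 < stepsize R k by rewrite invr_gt0 nat1r ltr0n.
have a0 k : (0 <= a k)%E by apply: integral_ge0 => w _; rewrite lee_fin sqr_ge0.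
have [||||||M M0 aM] := @ereal_contraction_decay R a q D1 D2.
- by apply/andP; split; [rewrite /q; nra | rewrite /q /e'; nra].
- by apply: mulr_ge0; rewrite ?sqr_ge0.
- by rewrite /D2 mulr_ge0 // mulr_ge0.
- by [].
- exact: hX0fin.
- move=> k; set s := (1 + k.+1%:R)^-1.
  have step w : l2norm (consensus_error (X k.+1 w)) ^+ 2 <=
      (q + D1 * s ^+ 2) * l2norm (consensus_error (X k w)) ^+ 2
      + (2 * (1 + e'^-1) * (2 * sigma * h) * s) * l2norm (Z k.+1 w) ^+ 2.
    have := consensus_error_step m0 Arow Acol (fun i => (hu i).1) hG gap e0
      (hX w k).
    have -> : Num.sqrt (2 * sigma * stepsize R k.+1 * h) ^+ 2 =
      2 * sigma * s * h.
      apply: sqr_sqrtr.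
      by apply: ltW; do 3?[apply: mulr_gt0 => //].
    have -> : (1 + e') * r + 2 * (1 + e'^-1) * (stepsize R k.+1 * h * G) ^+ 2 =
      q + D1 * s ^+ 2.
      by rewrite /D1 /q /stepsize -/s; ring.
    by have -> : 2 * (1 + e'^-1) * (2 * sigma * s * h) =
      2 * (1 + e'^-1) * (2 * sigma * h) * s by ring.
  have q0 : 0 <= q + D1 * s ^+ 2.
    rewrite addr_ge0 //; first by rewrite /q; nra.
    by rewrite mulr_ge0 ?sqr_ge0 // mulr_ge0 ?sqr_ge0.
  have d0 : 0 <= 2 * (1 + e'^-1) * (2 * sigma * h) * s.
    by rewrite !(mulr_ge0 (mulr_ge0 _ _)) // ltW // s0.
  have mN (f : T -> 'cV[R]_(m * d)) :
      measurable_fun setT (f : T -> borelV R (m * d)) ->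
      measurable_fun setT (fun w => (l2norm (f w) ^+ 2)%:E).
    by move=> mf; apply/measurable_EFinP; exact: measurable_l2norm_sqr.
  have N0 n (x : 'cV[R]_n) : (0 <= (l2norm x ^+ 2)%:E)%E
    by rewrite lee_fin sqr_ge0.
  (* The cross terms were absorbed pathwise, so the expectation of the bound splits by additivity
     into the previous error and the noise moment. *)
  apply: (@le_trans _ _ (\int[P]_w (
      (q + D1 * s ^+ 2)%:E * (l2norm (consensus_error (X k w)) ^+ 2)%:E
      + (2 * (1 + e'^-1) * (2 * sigma * h) * s)%:E
        * (l2norm (Z k.+1 w) ^+ 2)%:E))%E).
    apply: ge0_le_integral => //.
    - exact: mN.
    - by apply: emeasurable_funD; apply: emeasurable_funM => //; exact: mN.
    - by move=> w _; rewrite -!EFinM -EFinD lee_fin.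
  rewrite ge0_integralD //.
  + rewrite !ge0_integralZl //; [|exact: mN|exact: mN].
    rewrite (hV _ (hZgauss k)) -[(_ * V%:E)%E]EFinM -/(a k); apply: leeD => //.
    by rewrite lee_fin /D2 mulrAC.
  + by move=> w _; rewrite mule_ge0.
  + by apply: emeasurable_funM => //; exact: mN.
  + by move=> w _; rewrite mule_ge0.
  + by apply: emeasurable_funM => //; exact: mN.
have W k : (wasserstein 2 (error_law P (X k)) (@delta_origin R (m * d)) <=
    (Num.sqrt (M * (1 + k%:R)^-1))%:E)%E.
  apply: le_trans (wasserstein_dirac0_le P (mE k)) _.
  have Ms : 0 <= M * (1 + k%:R)^-1 by rewrite mulr_ge0 // ltW // s0.
  rewrite -powR12_sqrt // -poweR_EFin; apply: gt0_ler_poweR (aM k) => //.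
  - by rewrite in_itv /= leey a0.
  - by rewrite in_itv /= leey lee_fin Ms.
split.
  apply: (@squeeze_cvge _ _ _ _ (cst 0%E) _
    (fun k => (Num.sqrt (M * (1 + k%:R)^-1))%:E)).
  - by apply: nearW => k; rewrite wasserstein_ge0 W.
  - exact: cvg_cst.
  apply: cvg_EFin; first exact: nearW.
  rewrite -[0 in X in _ --> X](sqrtr0 R) -(mulr0 M).
  apply: (@continuous_cvg _ _ _ _ _ (fun k : nat => M * (1 + k%:R)^-1)
    Num.sqrt); first exact: sqrt_continuous.
  apply: cvgM; first exact: cvg_cst.
  rewrite (_ : (fun k => _) = harmonic); first exact: cvg_harmonic.
  by apply/funext => k; rewrite nat1r.
(* One constant serves every [gamma]: as 1 + k >= 1, lowering the exponent from 1/2 to 1/2 - gamma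
   only weakens the bound. *)
move=> gamma gamma0; exists (Num.sqrt M) => k.
apply: le_trans (W k) _; rewrite lee_fin sqrtrM // sqrtrV; last first.
  by rewrite addr_ge0.
rewrite ler_wpM2l // lef_pV2 ?posrE ?powR_gt0 ?sqrtr_gt0 ?nat1r ?ltr0n //.
rewrite -powR12_sqrt // ler_powR ?ler1n //; lra.
Qed.
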